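(* Let $X$ be a uniquely arcwise connected continuum and let $G$ be a countable amenable group acting on $X$ by homeomorphisms. Then the action has a periodic point of order $\leq 2$, i.e. there exists $x\in X$ whose orbit $Gx=\{gx: g\in G\}$ has at most $2$ elements.
   Context: A continuum is a connected compact metric space. An arc is a continuum homeomorphic to $[0,1]$. A continuum $X$ is uniquely arcwise connected if for any two points $x\neq y$ in $X$ there is a unique arc in $X$ connecting $x$ and $y$. An action of a (discrete) group $G$ on $X$ is a homomorphism from $G$ to the group of homeomorphisms of $X$; $gx$ denotes the image of $x$ under $g$. A point $x$ is periodic if its orbit $Gx$ is finite, and its order is then the cardinality of $Gx$. A countable group $G$ is amenable if there is a sequence of finite sets $F_i\subset G$ ($i=1,2,\dots$) with $\bigcup_i F_i=G$ and $\lim_{i\to\infty}|gF_i\,\triangle\, F_i|/|F_i|=0$ for every $g\in G$. *)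

(* Defs.v *)
From HB Require Import structures.
From mathcomp Require Import all_boot all_order all_algebra.
From mathcomp Require Import finmap.
From mathcomp Require Import all_classical all_reals all_analysis.
Set Implicit Arguments.
Unset Strict Implicit.
Unset Printing Implicit Defensive.
Import Order.TTheory GRing.Theory Num.Theory.
Import numFieldNormedType.Exports.
Local Open Scope classical_set_scope.
Local Open Scope ring_scope.

(* Continua are nonempty: [connected set0] holds in the library. *)
Definition continuum (T : topologicalType) (A : set T) : Prop :=
  [/\ A !=set0, compact A & connected A].

(* The subspaces A and B are homeomorphic through f and g; the values of f
   outside A and of g outside B are irrelevant. *)
Definition homeomorphism_on (T U : topologicalType) (A : set T) (B : set U)
    (f : T -> U) (g : U -> T) : Prop :=
  [/\ {homo f : x / A x >-> B x} /\ {homo g : y / B y >-> A y},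
      forall x, A x -> g (f x) = x,
      forall y, B y -> f (g y) = y,
      {within A, continuous f} &
      {within B, continuous g}].

Definition homeomorphism (T U : topologicalType) (f : T -> U) : Prop :=
  exists g : U -> T,
    [/\ cancel f g, cancel g f, continuous f & continuous g].

(* An arc connects x and y when these are its two endpoints. *)
Definition arc_connecting (R : realType) (X : metricType R) (x y : X)
    (A : set X) : Prop :=
  continuum A /\
  exists (f : R -> X) (g : X -> R),
    [/\ homeomorphism_on (`[0, 1]%classic : set R) A f g, f 0 = x & f 1 = y].

Definition uniquely_arcwise_connected (R : realType) (X : metricType R) : Prop :=
  forall x y : X, x <> y -> exists! A : set X, arc_connecting x y A.

Definition action_by_homeomorphisms (G : groupType) (X : topologicalType)
    (act : G -> X -> X) : Prop :=
  [/\ forall g, homeomorphism (act g),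
      forall x, act 1%g x = x &
      forall g h x, act (g * h)%g x = act g (act h x)].

Definition action_orbit (G : groupType) (X : Type) (act : G -> X -> X) (x : X) : set X :=
  [set act g x | g in [set: G]].

Definition fset_symdiff (K : choiceType) (A B : {fset K}) : {fset K} :=
  ((A `\` B) `|` (B `\` A))%fset.

Definition translate (G : groupType) (g : G) (F : {fset G}) : {fset G} :=
  [fset (g * h)%g | h in F]%fset.

(* The sets F i are required to be nonempty because 0 / 0 = 0 in R. *)
Definition amenable (R : realType) (G : groupType) : Prop :=
  exists F : nat -> {fset G},
    [/\ forall i, F i != fset0,
        \bigcup_i [set` F i] = [set: G] &
        forall g : G,
          (fun i => #|` fset_symdiff (translate g (F i)) (F i)|%:R
                    / #|` F i|%:R : R) @ \oo --> (0 : R)].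

(* Main.v *)
Require Import Defs.
From HB Require Import structures.
From mathcomp Require Import all_boot all_order all_algebra.
From mathcomp Require Import finmap.
From mathcomp Require Import all_classical all_reals all_analysis.
From mathcomp Require Import lra.
Set Implicit Arguments.
Unset Strict Implicit.
Unset Printing Implicit Defensive.
Import Order.TTheory GRing.Theory Num.Theory.
Import numFieldNormedType.Exports.
Local Open Scope classical_set_scope.
Local Open Scope ring_scope.

(** The arcs turn the space into a tree: arcs have medians ([arc_median]), and an
    arc from x to z lies in the union of the arcs from x to y and from y to z
    ([arc_tripod]).  Call the shadow of x seen from y the set of the points z such
    that the arc from y to z goes through x.  Amenability provides an invariant
    probability mu, and a center of mass of mu is invariant: call x central when
    the shadow of x has measure at least 1/2 seen from every point, that is, when
    no branch at x carries more than half of the mass.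

    Three facts give the theorem.  There is a central point
    ([central_nonempty]): otherwise every point has one branch of mass more than
    1/2, and following these branches leads to a point whose heavy branch would
    have to turn back.  Three disjoint shadows of mass 1/2 cannot exist, so the
    central points do not branch, and they lie on one arc whose two endpoints are
    central ([central_spanned]).  Homeomorphisms preserving mu permute the central
    points, so they permute these two endpoints ([arc_endpoints]).

    The delicate point is that an arcwise connected continuum may contain rays
    that do not converge, for instance in the Warsaw circle, and following heavy
    branches could lead along such a ray.  Countable additivity excludes this
    ([shadow_landing]): along a ray without endpoint the shadows decrease to the
    empty set.  Now the mean that amenability gives is only finitely additive, and
    shadows need not be closed.  Both defects are repaired by replacing the mean m
    by the infimum over open neighbourhoods U of the supremum of m over closed
    subsets of U.  By compactness and normality this outer capacity is submodular
    and continuous along all increasing sequences of sets ([capacity_ofP]), and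
    this is all that is needed: the sets A for which the capacities of A and of its
    complement add up to 1 behave like the measurable sets of a probability, and
    Choquet's capacitability argument ([capacitability]), applied to the space of
    parametrized arcs issued from y, shows that shadows are among them
    ([shadow_measurable]). *)

(** * Finitely additive probabilities and regular capacities *)

Lemma compact_nested (T : topologicalType) (K : set T) (C : nat -> set T) :
  compact K -> (forall n, closed (C n)) ->
  (forall n m, (n <= m)%N -> C m `<=` C n) ->
  (forall n, K `&` C n !=set0) -> K `&` \bigcap_n C n !=set0.
Proof.
move=> kK cC Cmono KC.
pose F := filter_from setT (fun n => K `&` C n).
have FF : ProperFilter F.
  apply: filter_from_proper => //; apply: filter_from_filter; first by exists 0%N.
  move=> i j _ _; exists (maxn i j) => // x [Kx Cx].
  split; split=> //; apply: Cmono Cx; [exact: leq_maxl|exact: leq_maxr].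
case: (kK F FF) => [|p [Kp clp]]; first by exists 0%N => // x [].
exists p; split=> // n _; apply: cC => B Bp.
have [|x [[_ Cx] Bx]] := clp (K `&` C n) B _ Bp; first by exists n.
by exists x.
Qed.

Record probability_content (R : realType) (T : Type) (m : set T -> R) : Prop := {
  content_ge0 : forall A, 0 <= m A;
  contentT : m [set: T] = 1;
  contentU : forall A B, A `&` B `<=` set0 -> m (A `|` B) = m A + m B }.

(** What survives, for all subsets of the space, of a regular Borel probability
    extended by its outer measure; measurability is not built in but recovered
    below from submodularity. *)
Record regular_capacity (R : realType) (X : topologicalType) (mu : set X -> R)
  : Prop := {
  capacity0 : mu set0 = 0;
  capacityT : mu [set: X] = 1;
  capacity_le : forall A B, A `<=` B -> mu A <= mu B;
  capacity_submod : forall A B, mu (A `|` B) + mu (A `&` B) <= mu A + mu B;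
  capacity_below : forall (A : nat -> set X) c,
    (forall n m, (n <= m)%N -> A n `<=` A m) ->
    c < mu (\bigcup_n A n) -> exists n, c < mu (A n);
  capacity_outer : forall A c, mu A < c ->
    exists U, [/\ open U, A `<=` U & mu U < c];
  capacity_open : forall U, open U -> mu U + mu (~` U) <= 1 }.

Section Content.
Context {R : realType} {T : Type} {m : set T -> R}.
Hypothesis mP : probability_content m.

Lemma content0 : m set0 = 0.
Proof.
have := contentU mP (A := set0) (B := set0).
by rewrite setU0 => /(_ (@subIsetl _ _ _)); lra.
Qed.

Lemma content_le A B : A `<=` B -> m A <= m B.
Proof.
move=> AB; rewrite -(setDUK AB) (contentU mP); last by move=> x [? []].
by have := content_ge0 mP (B `\` A); lra.
Qed.

(** The two-set inclusion-exclusion formula, from which submodularity of the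
    associated capacity is derived. *)
Lemma content_modular A B : m (A `|` B) + m (A `&` B) = m A + m B.
Proof.
have -> : A `|` B = A `|` (B `\` A).
  apply/seteqP; split=> x; first by case; [left|move=> Bx; have [|] := pselect (A x); [left|right]].
  by case; [left|move=> [? _]; right].
rewrite (contentU mP); last by move=> x [? []].
have {3}-> : B = (B `\` A) `|` (A `&` B).
  apply/seteqP; split=> x; last by case=> -[].
  by move=> Bx; have [|] := pselect (A x); [right|left].
by rewrite (contentU mP (A := B `\` A)) ?addrA// => x [[_ nA] []].
Qed.

End Content.

Section CapacityOfContent.
Context {R : realType} {X : topologicalType} (m : set X -> R).
Hypothesis mP : probability_content m.

(** Only the values of m on closed sets are kept; two finitely additive m can
    differ elsewhere in ways that ignore the topology. *)
Definition inner_content (U : set X) : R :=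
  sup [set m F | F in [set F | closed F /\ F `<=` U]].

Definition capacity_of (A : set X) : R :=
  inf [set inner_content U | U in [set U | open U /\ A `<=` U]].

Local Notation lam := inner_content.
Local Notation mu := capacity_of.

Let content_le1 A : m A <= 1.
Proof. by rewrite -(contentT mP); apply: content_le. Qed.

Let lam_nonempty U : [set m F | F in [set F | closed F /\ F `<=` U]] !=set0.
Proof. by exists (m set0), set0 => //; split=> //; exact: closed0. Qed.

Let lam_ub U : has_ubound [set m F | F in [set F | closed F /\ F `<=` U]].
Proof. by exists 1 => _ [F _ <-]. Qed.

Let le_lam U F : closed F -> F `<=` U -> m F <= lam U.
Proof. by move=> cF FU; apply: ub_le_sup => //; exists F. Qed.

Let lam_leP U c : (forall F, closed F -> F `<=` U -> m F <= c) -> lam U <= c.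
Proof. by move=> H; apply: ge_sup => // _ [F [cF FU] <-]; exact: H. Qed.

Let lam_gt U c : c < lam U -> exists F, [/\ closed F, F `<=` U & c < m F].
Proof.
by move=> /sup_gt[//|_ [F [cF FU] <-] cF']; exists F; split.
Qed.

Let lam_le U V : U `<=` V -> lam U <= lam V.
Proof. by move=> UV; apply: lam_leP => F cF FU; apply: le_lam => // x /FU/UV. Qed.

Let lam_ge0 U : 0 <= lam U.
Proof. by rewrite -(content0 mP); apply: le_lam => //; exact: closed0. Qed.

Let lamT : lam [set: X] = 1.
Proof.
apply/eqP; rewrite eq_le; apply/andP; split; first exact: lam_leP.
by rewrite -(contentT mP); apply: le_lam => //; exact: closedT.
Qed.

Let mu_lb A : has_lbound [set lam U | U in [set U | open U /\ A `<=` U]].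
Proof. by exists 0 => _ [U _ <-]. Qed.

Let mu_nonempty A : [set lam U | U in [set U | open U /\ A `<=` U]] !=set0.
Proof. by exists (lam [set: X]), [set: X] => //; split=> //; exact: openT. Qed.

Let mu_le_lam A U : open U -> A `<=` U -> mu A <= lam U.
Proof. by move=> oU AU; apply: ge_inf => //; exists U. Qed.

Let le_muP A c : (forall U, open U -> A `<=` U -> c <= lam U) -> c <= mu A.
Proof. by move=> H; apply: lb_le_inf => // _ [U [oU AU] <-]; exact: H. Qed.

Let mu_lt A c : mu A < c -> exists U, [/\ open U, A `<=` U & lam U < c].
Proof. by move=> /inf_lt[//|_ [U [oU AU] <-] cU]; exists U; split. Qed.

Let mu_open U : open U -> mu U = lam U.
Proof.
move=> oU; apply/eqP; rewrite eq_le mu_le_lam//=.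
by apply: le_muP => V oV; exact: lam_le.
Qed.

Let mu_le A B : A `<=` B -> mu A <= mu B.
Proof. by move=> AB; apply: le_muP => U oU BU; apply: mu_le_lam => // x /AB/BU. Qed.

Hypothesis X_normal : normal_space X.

(* Shrinking lemma: with it, a closed subset of U union V is controlled by closed
   subsets of U and of V separately. *)
Let closed_split (F U V : set X) : closed F -> open U -> open V -> F `<=` U `|` V ->
  exists F1 F2, [/\ closed F1, closed F2, F1 `<=` U, F2 `<=` V & F `<=` F1 `|` F2].
Proof.
move=> cF oU oV FUV.
have cA : closed (F `\` U) by rewrite setDE; apply: closedI => //; exact: open_closedC.
case: (@X_normal _ cA V) => [x [/FUV[//|Vx] _]|B AB BV].
  exact: open_nbhs_nbhs.
have [W [oW AW WB]] : exists W, [/\ open W, F `\` U `<=` W & W `<=` B].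
  exists (interior B); split; [exact: open_interior| |exact: interior_subset].
  by move=> x /AB.
exists (F `\` W), (F `&` closure B); split.
- by rewrite setDE; apply: closedI => //; exact: open_closedC.
- by apply: closedI => //; exact: closed_closure.
- by move=> x [Fx nWx]; apply: contrapT => nU; apply: nWx; exact: AW.
- by move=> x [_ /BV].
- move=> x Fx; have [Wx|nWx] := pselect (W x); last by left.
  by right; split=> //; apply: subset_closure; exact: WB.
Qed.

Let lam_submod U V : open U -> open V -> lam (U `|` V) + lam (U `&` V) <= lam U + lam V.
Proof.
move=> oU oV; rewrite -lerBrDr; apply: lam_leP => F cF FUV.
rewrite lerBrDr addrC -lerBrDr; apply: lam_leP => F' cF' FUV'.
rewrite lerBrDr addrC.
have [F1 [F2 [c1 c2 s1 s2 FF]]] := closed_split cF oU oV FUV.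
apply: (@le_trans _ _ (m ((F1 `|` F') `|` (F2 `|` F')) + m ((F1 `|` F') `&` (F2 `|` F')))).
  apply: lerD; apply: content_le => //.
  - by move=> x /FF[]; [left|right]; left.
  - by move=> x F'x; split; right.
rewrite (content_modular mP); apply: lerD; apply: le_lam; try exact: closedU.
- by move=> x [/s1//|/FUV'[]].
- by move=> x [/s2//|/FUV'[]].
Qed.

Hypothesis X_compact : compact [set: X].

(* A closed set is compact, so one U n already contains it. *)
Let lam_below (U : nat -> set X) c : (forall n, open (U n)) ->
  (forall n m, (n <= m)%N -> U n `<=` U m) ->
  c < lam (\bigcup_n U n) -> exists n, c < lam (U n).
Proof.
move=> oU Umono /lam_gt[F [cF FU cmF]].
have kF : compact F by apply: subclosed_compact X_compact _.
apply: contrapT => nU.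
have [|n k nk x nUx Ux|n|x [Fx nUx]] := compact_nested (C := fun n => ~` U n) kF.
- by move=> n; exact: open_closedC.
- by apply: nUx; exact: Umono Ux.
- apply: contrapT => /set0P/negP; rewrite negbK => /eqP FU0; apply: nU; exists n.
  apply: lt_le_trans cmF _; apply: le_lam => // x Fx; apply: contrapT => nUx.
  by have : (F `&` ~` U n) x; [split|rewrite FU0].
- by have [n _ Ux] := FU _ Fx; exact: (nUx n).
Qed.

Let mu_submod A B : mu (A `|` B) + mu (A `&` B) <= mu A + mu B.
Proof.
apply/ler_addgt0Pr => e e0.
have /mu_lt[U [oU AU lU]] : mu A < mu A + e / 2 by rewrite ltrDl divr_gt0.
have /mu_lt[V [oV BV lV]] : mu B < mu B + e / 2 by rewrite ltrDl divr_gt0.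
have h1 : mu (A `|` B) <= lam (U `|` V) by apply: mu_le_lam; [exact: openU|exact: setUSS].
have h2 : mu (A `&` B) <= lam (U `&` V) by apply: mu_le_lam; [exact: openI|exact: setISS].
have := lam_submod oU oV; lra.
Qed.

(* Open neighbourhoods U n of A n with errors e / 2 ^ n.+1 are added up; since A n
   lies in both V n and U n.+1, submodularity keeps the error of their union V
   below e. *)
Let mu_below (A : nat -> set X) c : (forall n m, (n <= m)%N -> A n `<=` A m) ->
  c < mu (\bigcup_n A n) -> exists n, c < mu (A n).
Proof.
move=> Amono; set s := mu _ => cs.
apply: contrapT => nA.
have Ac n : mu (A n) <= c by rewrite leNgt; apply/negP => h; apply: nA; exists n.
pose e := (s - c) / 2; have e0 : 0 < e by rewrite divr_gt0 ?subr_gt0.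
have hU n : exists U, [/\ open U, A n `<=` U & lam U < mu (A n) + e / 2 ^+ n.+1].
  by apply: mu_lt; rewrite ltrDl divr_gt0 ?exprn_gt0.
pose U n := sval (cid (hU n)).
have [oU AU lU] : [/\ forall n, open (U n), forall n, A n `<=` U n &
    forall n, lam (U n) < mu (A n) + e / 2 ^+ n.+1].
  by split=> n; rewrite /U; case: cid => ? [].
pose V n := \bigcup_(k in `I_n.+1) U k.
have oV n : open (V n) by apply: bigcup_open.
have VS n : V n.+1 = V n `|` U n.+1 by rewrite /V !bigcup_mkord big_ord_recr.
have AV n : A n `<=` V n by move=> x Ax; exists n => //=; exact: AU.
have lV n : lam (V n) <= mu (A n) + e * (1 - (2 ^+ n.+1)^-1).
  elim: n => [|n IH].
    rewrite /V bigcup_mkord big_ord_recr /= big_ord0 set0U.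
    have := lU 0%N; rewrite expr1; lra.
  have := lam_submod (oV n) (oU n.+1); rewrite -VS.
  have : mu (A n) <= lam (V n `&` U n.+1).
    apply: mu_le_lam; first exact: openI.
    by move=> x Ax; split; [exact: AV|apply: AU; apply: Amono Ax].
  have := lU n.+1; rewrite [2 ^+ n.+2]exprS invfM.
  set w := (2 ^+ n.+1)^-1; move: IH; rewrite -/w; lra.
have : c + e < lam (\bigcup_n V n).
  apply: (@lt_le_trans _ _ s); first by rewrite /e; lra.
  apply: mu_le_lam; first by apply: bigcup_open.
  by move=> x [n _ /AV]; exists n.
move=> /lam_below[|n k nk x [i /= ik Ux]|n] //.
  by exists i => //=; apply: leq_trans ik _.
apply/negP; rewrite -leNgt; apply: (le_trans (lV n)); apply: lerD => //.
by rewrite -[leRHS]mulr1 ler_wpM2l ?ltW// lerBlDr lerDl invr_ge0 exprn_ge0.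
Qed.

(** Continuity from below holds for arbitrary sets, although m is only finitely
    additive: compactness replaces countable additivity on open sets, and
    submodularity carries it over to their subsets. *)
Theorem capacity_ofP : regular_capacity mu.
Proof.
split=> //.
- rewrite mu_open; last exact: open0.
  apply/eqP; rewrite eq_le lam_ge0 andbT; apply: lam_leP => F _.
  by rewrite subset0 => ->; rewrite content0.
- by rewrite mu_open //; exact: openT.
- move=> A c /mu_lt[U [oU AU lU]]; exists U; split=> //.
  by rewrite mu_open.
- move=> U oU; rewrite mu_open// -lerBrDr; apply: lam_leP => F cF FU.
  rewrite lerBrDr addrC -lerBrDr; apply: (@le_trans _ _ (lam (~` F))).
    apply: mu_le_lam; first exact: closed_openC.
    exact: subsetC.
  apply: lam_leP => E cE EF; rewrite lerBrDr -(contentU mP) //.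
  by move=> x [/EF].
Qed.

Lemma capacity_of_preimage (f g : X -> X) : continuous f -> continuous g ->
  cancel f g -> cancel g f -> (forall A, m (f @^-1` A) = m A) ->
  forall A, mu (f @^-1` A) = mu A.
Proof.
move=> fc gc fg gf mf.
have preK A : f @^-1` (g @^-1` A) = A by apply/seteqP; split=> x; rewrite /preimage/= fg.
have preK' A : g @^-1` (f @^-1` A) = A by apply/seteqP; split=> x; rewrite /preimage/= gf.
have mg A : m (g @^-1` A) = m A by rewrite -mf preK.
have lamle h : continuous h -> (forall A, m (h @^-1` A) = m A) ->
    forall U, lam U <= lam (h @^-1` U).
  move=> hc mh U; apply: lam_leP => F cF FU; rewrite -mh; apply: le_lam.
    by move/continuous_closedP: hc; apply.
  by move=> x /FU.
have mule h h' : continuous h -> (forall A, m (h' @^-1` A) = m A) ->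
    continuous h' -> (forall A, h' @^-1` (h @^-1` A) = A) ->
    forall A, mu (h @^-1` A) <= mu A.
  move=> hc mh hc' hK A; apply: le_muP => U oU AU.
  apply: (@le_trans _ _ (lam (h @^-1` U))).
    apply: mu_le_lam; last by move=> x /AU.
    by move/continuousP: hc; apply.
  by rewrite -[in leRHS](hK U); exact: lamle.
move=> A; apply/eqP; rewrite eq_le (mule f g)//=.
by rewrite -{1}(preK' A) (mule g f).
Qed.

End CapacityOfContent.

(** * Measurable sets of a regular capacity *)

Section Capacity.
Context {R : realType} {X : topologicalType} {mu : set X -> R}.
Hypothesis muP : regular_capacity mu.

(** Subadditivity gives the opposite inequality, so that these are the sets on
    which outer and inner measure agree. *)
Definition capacity_measurable (nu : set X -> R) (A : set X) : Prop :=
  nu A + nu (~` A) <= 1.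

Local Notation measurable A := (capacity_measurable mu A).

Lemma capacity_ge0 A : 0 <= mu A.
Proof. by rewrite -(capacity0 muP); exact: capacity_le. Qed.

Lemma capacity_subadditive A B : mu (A `|` B) <= mu A + mu B.
Proof. by have := capacity_submod muP A B; have := capacity_ge0 (A `&` B); lra. Qed.

Lemma capacity_ge1C A : 1 <= mu A + mu (~` A).
Proof. by have := capacity_subadditive A (~` A); rewrite setUv (capacityT muP). Qed.

Lemma capacity_measurable_open U : open U -> measurable U.
Proof. exact: capacity_open. Qed.

Lemma capacity_measurableC A : measurable A -> measurable (~` A).
Proof. by rewrite /capacity_measurable setCK addrC. Qed.

Lemma capacity_measurable_closed F : closed F -> measurable F.
Proof.
by move=> /closed_openC/capacity_measurable_open/capacity_measurableC; rewrite setCK.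
Qed.

(** Submodularity for A, B and for their complements adds up to at most 2, while
    the capacities of the union and of the intersection add up with those of
    their complements to at least 1 each. *)
Lemma capacity_measurableU A B : measurable A -> measurable B -> measurable (A `|` B).
Proof.
rewrite /capacity_measurable => mA mB.
have := capacity_submod muP A B; have := capacity_submod muP (~` A) (~` B).
rewrite -setCI -setCU.
by have := capacity_ge1C (A `|` B); have := capacity_ge1C (A `&` B); lra.
Qed.

Lemma capacity_measurableI A B : measurable A -> measurable B -> measurable (A `&` B).
Proof.
move=> mA mB; rewrite -(setCK (A `&` B)) setCI; apply: capacity_measurableC.
by apply: capacity_measurableU; exact: capacity_measurableC.
Qed.

Lemma capacity_disjoint A B : measurable A -> A `&` B `<=` set0 -> mu A + mu B <= 1.
Proof.
move=> mA AB; apply: le_trans mA; rewrite lerD2l; apply: (capacity_le muP) => x Bx Ax.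
exact: (AB x).
Qed.

(** C lies in the intersection of the complements of A and B, whose capacity is at
    most 1 - mu A - mu B by submodularity. *)
Lemma capacity_disjoint3 A B C : measurable A -> measurable B ->
  A `&` B `<=` set0 -> A `&` C `<=` set0 -> B `&` C `<=` set0 ->
  mu A + mu B + mu C <= 1.
Proof.
rewrite /capacity_measurable => mA mB AB AC BC.
have := capacity_submod muP (~` A) (~` B).
have -> : ~` A `|` ~` B = [set: X].
  by rewrite -setCI; apply/seteqP; split=> // x _ /AB.
rewrite (capacityT muP).
have /(capacity_le muP) : C `<=` ~` A `&` ~` B.
  by move=> x Cx; split=> h; [exact: (AC x)|exact: (BC x)].
lra.
Qed.

Lemma capacity_above (A : nat -> set X) c :
  (forall n m, (n <= m)%N -> A m `<=` A n) -> (forall n, measurable (A n)) ->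
  (forall n, c <= mu (A n)) -> c <= mu (\bigcap_n A n).
Proof.
move=> Amono mA cA; rewrite leNgt; apply/negP => lt_c.
have [n m nm||n lt1] := @capacity_below _ _ _ muP (fun n => ~` A n) (1 - c).
- exact/subsetC/Amono.
- by rewrite -setC_bigcap; have := capacity_ge1C (\bigcap_n A n); lra.
- by have := mA n; have := cA n; rewrite /capacity_measurable; move: lt1; lra.
Qed.

(** The part of Lusin's theorem that is used: a set is measurable as soon as it is
    relatively closed in closed sets of almost full capacity. *)
Lemma capacity_measurable_approx S :
  (forall c, c < 1 -> exists E, [/\ closed E, closed (S `&` E) & c <= mu E]) ->
  measurable S.
Proof.
move=> H; apply/ler_addgt0Pr => e e0.
have [|E [cE cSE muE]] := H (1 - e); first by lra.
have mK := capacity_measurable_closed cSE.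
have mL : measurable (E `&` ~` (S `&` E)).
  apply: capacity_measurableI; first exact: capacity_measurable_closed.
  exact: capacity_measurableC.
have : mu S <= mu (~` (E `&` ~` (S `&` E))).
  by apply: (capacity_le muP) => x Sx [Ex]; apply.
have : mu (~` S) <= mu (~` (S `&` E)) by apply: (capacity_le muP) => x nS [].
have := capacity_subadditive (S `&` E) (E `&` ~` (S `&` E)).
have : mu E <= mu ((S `&` E) `|` (E `&` ~` (S `&` E))).
  apply: (capacity_le muP) => x Ex.
  by have [Sx|nSx] := pselect (S x); [left|right; split=> // -[]].
by move: mK mL; rewrite /capacity_measurable; lra.
Qed.

(** * Capacitability of projections *)

Section Capacitability.
Context {Z : topologicalType} (p : Z -> X) (C : nat -> nat -> set Z).
Hypotheses (Z_compact : compact [set: Z]) (p_continuous : continuous p).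
Hypotheses (C_closed : forall k n, closed (C k n)).
Hypothesis (C_mono : forall k n m, (n <= m)%N -> C k n `<=` C k m).

Let D := \bigcap_k \bigcup_n C k n.

Let box (l : seq nat) : set Z :=
  D `&` [set z | forall i, (i < size l)%N -> C i (nth 0%N l i) z].

(** Choquet's theorem for the image of a K-sigma-delta set D.  By continuity from
    below the bounds s 0, s 1, and so on are chosen one after the other so that
    the image of the part of D obeying the first k bounds keeps capacity
    above c; by compactness an open set that contains the image of the
    intersection contains one of these images. *)
Lemma capacitability c : c < mu (p @` D) ->
  exists s : nat -> nat, c <= mu (p @` (\bigcap_k C k (s k))).
Proof.
move=> cD.
(* One more bound: the union over n of the boxes with bound n at scale [size l] is
   the box without that bound. *)
have step (l : seq nat) : exists n, c < mu (p @` box l) -> c < mu (p @` box (rcons l n)).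
  have [cl|] := pselect (c < mu (p @` box l)); last by exists 0%N.
  have [n m nm _ [z [Dz boxz] <-]||n cn] := @capacity_below _ _ _ muP
      (fun n => p @` box (rcons l n)) c.
  - exists z => //; split=> // i il; have := boxz i.
    rewrite /= !size_rcons !nth_rcons in il * => /(_ il).
    by move: il; rewrite ltnS leq_eqVlt => /orP[/eqP->|->] //;
      rewrite ltnn eqxx; exact: C_mono.
  - suff -> : \bigcup_n p @` box (rcons l n) = p @` box l by [].
    apply/seteqP; split=> [_ [n _ [z [Dz boxz] <-]]|_ [z [Dz boxz] <-]].
      exists z => //; split=> // i il; have := boxz i.
      by rewrite size_rcons nth_rcons il; apply; exact: ltnW.
    have [n _ Cz] := Dz (size l) I.
    exists n => //; exists z => //; split=> // i; rewrite size_rcons nth_rcons ltnS.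
    by case: ltngtP => // [il _|-> _]; [exact: boxz|].
  - by exists n.
pose f l := sval (cid (step l)).
pose L := fix L k := if k is k'.+1 then rcons (L k') (f (L k')) else [::].
pose s k := f (L k).
have sizeL k : size (L k) = k by elim: k => //= k IH; rewrite size_rcons IH.
have nthL k i : (i < k)%N -> nth 0%N (L k) i = s i.
  elim: k => // k IH; rewrite ltnS leq_eqVlt => /orP[/eqP->|ik] /=;
  by rewrite nth_rcons sizeL ?ltnn ?eqxx ?ik ?IH.
have cL k : c < mu (p @` box (L k)).
  elim: k => [|k IH] /=.
    suff -> : box [::] = D by [].
    by apply/seteqP; split=> [z []|z Dz] //; split.
  by rewrite /f; case: cid => n /=; exact.
exists s; rewrite leNgt; apply/negP => /(capacity_outer muP)[U [oU EU muU]].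
pose B k := [set z | forall i, (i < k)%N -> C i (s i) z].
have [|k|n m nm z Bz i il|k|z [nUz Bz]] := compact_nested (K := p @^-1` (~` U)) (C := B).
- apply: subclosed_compact Z_compact _ => //.
  by move/continuous_closedP: p_continuous; apply; exact: open_closedC.
- have -> : B k = \bigcap_(i in [set i | (i < k)%N]) C i (s i).
    by apply/seteqP; split.
  by apply: closed_bigI => i _; exact: C_closed.
- by apply: Bz; exact: leq_trans nm.
- apply: contrapT => /set0P/negP; rewrite negbK => /eqP UB0.
  have /(capacity_le muP) : p @` box (L k) `<=` U.
    move=> _ [z [Dz boxz] <-]; apply: contrapT => nU.
    suff : (p @^-1` (~` U) `&` B k) z by rewrite UB0.
    by split=> // i ik; rewrite -(nthL k)//; apply: boxz; rewrite sizeL.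
  by have := cL k; move: muU; lra.
- by apply: nUz; apply: EU; exists z => // k _; exact: (Bz k.+1).
Qed.

End Capacitability.

End Capacity.

(** * Invariant means of amenable groups *)

Lemma ultrafilter_cvg_compact (I : Type) (T : topologicalType) (U : set_system I)
    (K : set T) (f : I -> T) : UltraFilter U -> compact K -> (forall i, K (f i)) ->
  exists l : T, f @ U --> l.
Proof.
move=> UU kK Kf.
have [|l [_ cl]] := kK (f @ U) (fmap_proper_filter _ _); [|idtac].
  by apply: (@filterE _ U) => i; exact: Kf.
exists l => B Bl; have [//|nB] := in_ultra_setVsetC (f @^-1` B) UU.
by have [x [nBx Bx]] := cl (~` B) B nB Bl.
Qed.

Section InvariantMean.
Context {R : realType} {G : groupType} {X : Type} {act : G -> X -> X}.
Hypothesis act_mul : forall g h x, act (g * h)%g x = act g (act h x).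

Let visits (F : {fset G}) (x0 : X) (A : set X) : {fset G} :=
  [fset h in F | `[< A (act h x0) >]]%fset.

Let freq (F : {fset G}) (x0 : X) (A : set X) : R := #|` visits F x0 A|%:R / #|` F|%:R.

Let freq_ge0 F x0 A : 0 <= freq F x0 A.
Proof. exact: divr_ge0. Qed.

Let freqT F x0 : F != fset0 -> freq F x0 [set: X] = 1.
Proof.
move=> F0; rewrite /freq; have -> : visits F x0 [set: X] = F.
  by apply/fsetP => h; rewrite !inE asboolT ?andbT.
by rewrite divff // pnatr_eq0 cardfs_eq0.
Qed.

Let freqU F x0 A B : A `&` B `<=` set0 ->
  freq F x0 (A `|` B) = freq F x0 A + freq F x0 B.
Proof.
move=> AB; rewrite /freq -mulrDl -natrD.
have -> : visits F x0 (A `|` B) = (visits F x0 A `|` visits F x0 B)%fset.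
  by apply/fsetP => h; rewrite !inE asbool_or andb_orr.
rewrite cardfsU; suff -> : (visits F x0 A `&` visits F x0 B)%fset = fset0.
  by rewrite cardfs0 subn0.
apply/fsetP => h; rewrite !inE; apply/negP.
by move=> /andP[/andP[_ /asboolP Ah] /andP[_ /asboolP Bh]]; exact: (AB (act h x0)).
Qed.

(* Visits of h x0 to the preimage of A under g, for h in F, are visits of k x0 to A,
   for k in the translate of F by g. *)
Let card_visits_translate F g x0 A :
  #|` visits F x0 (act g @^-1` A)| = #|` visits (translate g F) x0 A|.
Proof.
have -> : visits (translate g F) x0 A = translate g (visits F x0 (act g @^-1` A)).
  apply/fsetP => k; apply/idP/imfsetP => /=.
    rewrite !inE => /andP[/imfsetP[h /= hF ->] /asboolP Ah].
    by exists h => //; rewrite !inE hF; apply/asboolP; rewrite /preimage /= -act_mul.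
  move=> [h]; rewrite !inE => /andP[hF /asboolP Ah] ->.
  rewrite in_imfset //=; apply/asboolP; rewrite act_mul; exact: Ah.
by rewrite /translate [RHS]card_imfset //= => h k /mulgI.
Qed.

Let card_visits_le E F x0 A :
  (#|` visits E x0 A| <= #|` visits F x0 A| + #|` fset_symdiff E F|)%N.
Proof.
apply: (@leq_trans #|` visits F x0 A `|` fset_symdiff E F|%fset).
  apply/fsubset_leq_card/fsubsetP => h; rewrite !inE => /andP[-> ->].
  by rewrite !andbT; case: (h \in F).
by rewrite cardfsU leq_subr.
Qed.

Let fset_symdiffC (E F : {fset G}) : fset_symdiff E F = fset_symdiff F E.
Proof. by rewrite /fset_symdiff fsetUC. Qed.

Let freq_translate F g x0 A :
  `|freq F x0 (act g @^-1` A) - freq F x0 A| <=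
  #|` fset_symdiff (translate g F) F|%:R / #|` F|%:R.
Proof.
rewrite /freq -mulrBl normrM (@ger0_norm _ (_^-1)) ?invr_ge0 // ler_wpM2r ?invr_ge0 //.
rewrite card_visits_translate ler_norml.
have := card_visits_le (translate g F) F x0 A.
have := card_visits_le F (translate g F) x0 A.
rewrite [fset_symdiff F _]fset_symdiffC -!(ler_nat R) !natrD.
by move=> h1 h2; apply/andP; split; lra.
Qed.

(** The mean is the limit, along an ultrafilter, of the frequencies of the visits
    of x0 to a set under the Foelner sets; the Foelner condition makes it
    invariant. *)
Theorem amenable_invariant_content (x0 : X) : amenable R G ->
  exists m : set X -> R, probability_content m /\
    forall g A, m (act g @^-1` A) = m A.
Proof.
move=> [F [F0 _ Finv]].
have [U [UU ooU]] := ultraFilterLemma (eventually_filter : ProperFilter \oo).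
pose a A i := freq (F i) x0 A.
have freq_le1 A i : freq (F i) x0 A <= 1.
  have := freqU (F i) x0 (A := A) (B := ~` A); rewrite setUv setICr freqT //.
  by move=> /(_ (@subset_refl _ _)); have := freq_ge0 (F i) x0 (~` A); lra.
have ex A : exists l : R, a A @ U --> l.
  apply: (ultrafilter_cvg_compact UU (@segment_compact R 0 1)) => i.
  by rewrite /= in_itv /= freq_ge0 freq_le1.
pose m A := sval (cid (ex A)).
have mP A : a A @ U --> m A by rewrite /m; case: cid.
exists m; split; first split.
- move=> A; apply: (closed_cvg (fun x : R => 0 <= x)) (mP A); first exact: closed_ge.
  by apply: filterE => i; exact: freq_ge0.
- apply: (cvg_unique (@Rhausdorff R) (mP [set: X])).
  by apply: cvg_near_cst; apply: filterE => i; exact: freqT.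
- move=> A B AB; apply: (cvg_unique (@Rhausdorff R) (mP (A `|` B))).
  rewrite [a _](_ : _ = a A \+ a B); first exact: cvgD.
  by apply/funext => i; exact: freqU.
- move=> g A; apply: (cvg_unique (@Rhausdorff R) (mP (act g @^-1` A))).
  rewrite [a _](_ : _ = a A \+ (a (act g @^-1` A) \- a A)); last first.
    by apply/funext => i /=; rewrite addrC subrK.
  rewrite -[m A]addr0; apply: cvgD => //.
  apply/cvgr0Pnorm_lt => e e0.
  have /cvgr0Pnorm_lt/(_ e e0)/ooU := Finv g.
  apply: filterS => i /= lt_e; apply: le_lt_trans (freq_translate _ _ _ _) _.
  exact: le_lt_trans (ler_norm _) lt_e.
Qed.

End InvariantMean.

(** * Arcs of a uniquely arcwise connected space *)

Section Arcs.
Context {R : realType} {X : metricType R}.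

(** Parametrizing by [0, b] with b = 0 allowed treats the degenerate arc from a
    point to itself like the others; continuity on the whole line avoids
    subspace topologies when paths are cut and glued. *)
Definition injective_path (f : R -> X) (b : R) : Prop :=
  [/\ 0 <= b, continuous f &
      forall s t : R, 0 <= s <= b -> 0 <= t <= b -> f s = f t -> s = t].

Definition arc (x y : X) : set X :=
  [set z | (x = y /\ z = x) \/ exists f, [/\ injective_path f 1, f 0 = x, f 1 = y &
     exists2 t : R, 0 <= t <= 1 & z = f t]].

Lemma segmentE (a b t : R) : `[a, b]%classic t = (a <= t <= b) :> Prop.
Proof. by rewrite /= in_itv. Qed.

Let metric_closed (A : set X) : compact A -> closed A.
Proof. by apply: compact_closed; exact: metric_hausdorff. Qed.

Lemma injective_path_compact f b s t : injective_path f b ->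
  compact (f @` `[s, t]).
Proof.
move=> [_ fc _]; apply: continuous_compact; last exact: segment_compact.
exact: continuous_subspaceT.
Qed.

Lemma arc_connecting_injective_path f : injective_path f 1 ->
  arc_connecting (f 0) (f 1) (f @` `[0, 1]).
Proof.
move=> fP; have [_ fc finj] := fP.
have fcw : {within `[0, 1], continuous f} by exact: continuous_subspaceT.
split; first split.
- by exists (f 0), 0 => //; rewrite segmentE lexx ler01.
- exact: injective_path_compact fP.
- by apply: connected_continuous_connected fcw; exact: segment_connected.
pose g y := if pselect (exists2 t : R, 0 <= t <= 1 & f t = y) is left e
  then s2val (cid2 e) else 0.
have gP (t : R) : 0 <= t <= 1 -> g (f t) = t.
  move=> t01; rewrite /g; case: pselect => [e|[]]; last by exists t.
  by case: cid2 => s /= s01 fst; apply: finj.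
exists f, g; split=> //; split=> //.
- split=> [x|_ [t t01 <-]]; first by exists x.
  by rewrite gP // -segmentE.
- by move=> _ [t + <-]; rewrite segmentE => t01; rewrite gP.
- apply/continuous_closedP => C cC.
  apply/closed_subspaceP; exists (f @` (`[0, 1] `&` C)).
    apply: metric_closed; apply: continuous_compact.
      exact: continuous_subspaceT.
    by apply: compact_closedI => //; exact: segment_compact.
  apply/seteqP; split=> [_ [[t [t01 Ct] <-] h]|y [Cy [t t01 fty]]];
    have t01' : 0 <= t <= 1 by rewrite -segmentE.
    by split=> //; change (C (g (f t))); rewrite gP.
  have Ct : C t by rewrite -(gP t) // fty.
  by split; exists t.
Qed.

Definition unit_clamp (t : R) : R := Num.max 0 (Num.min 1 t).

Lemma unit_clamp01 t : `[0, 1]%classic (unit_clamp t).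
Proof. by rewrite /unit_clamp segmentE le_max lexx /= ge_max ler01 ge_min lexx. Qed.

Lemma unit_clamp_id t : 0 <= t <= 1 -> unit_clamp t = t.
Proof. by move=> /andP[t0 t1]; rewrite /unit_clamp (min_r t1) (max_r t0). Qed.

Lemma unit_clamp_continuous : continuous unit_clamp.
Proof.
move=> t; apply: (@continuous_max R R (cst 0) (fun t => Num.min 1 t)).
  exact: cst_continuous.
by apply: (@continuous_min R R (cst 1) id); [exact: cst_continuous|].
Qed.

Lemma injective_path_clamp (f : R -> X) : {within `[0, 1], continuous f} ->
  (forall s t : R, 0 <= s <= 1 -> 0 <= t <= 1 -> f s = f t -> s = t) ->
  injective_path (f \o unit_clamp) 1.
Proof.
move=> fc finj; split=> //.
  move/subspace_continuousP: fc => fc t B /= fB.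
  have {}fB : nbhs t (fun s => `[0, 1]%classic (unit_clamp s) -> B (f (unit_clamp s))) :=
    unit_clamp_continuous (fc _ (unit_clamp01 t) B fB).
  change (nbhs t ((f \o unit_clamp) @^-1` B)).
  by apply: filterS fB => s; apply; exact: unit_clamp01.
by move=> s t s01 t01; rewrite /= !unit_clamp_id //; exact: finj.
Qed.

Lemma injective_path_of_arc x y A : arc_connecting x y A ->
  exists f, [/\ injective_path f 1, f 0 = x, f 1 = y & A = f @` `[0, 1]].
Proof.
move=> [_ [f [g [[[fA gA] fK gK fc _] f0 f1]]]].
exists (f \o unit_clamp); split.
- apply: injective_path_clamp => // s t s01 t01 fst.
  by rewrite -(fK s) ?segmentE// -(fK t) ?segmentE// fst.
- by rewrite /= unit_clamp_id // lexx ler01.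
- by rewrite /= unit_clamp_id // lexx ler01.
- apply/seteqP; split=> [z Az|_ [t t01 <-]]; last first.
    by rewrite /= unit_clamp_id -?segmentE//; exact: fA.
  exists (g z); first exact: gA.
  by rewrite /= unit_clamp_id ?gK// -segmentE; exact: gA.
Qed.

Lemma injective_path_affine f (b a c : R) : injective_path f b -> 0 <= a ->
  a <= c -> c <= b -> injective_path (fun t => f (a + t)) (c - a).
Proof.
move=> [b0 fc finj] a0 ac cb; split; first by rewrite subr_ge0.
  move=> t; apply: (@continuous_comp _ _ _ (fun t => a + t) f); last exact: fc.
  by apply: continuousD; [exact: cst_continuous|].
move=> s t /andP[s0 sc] /andP[t0 tc] /finj h.
by apply: (addrI a); apply: h; apply/andP; split; lra.
Qed.

Lemma injective_path_scale f (b : R) : injective_path f b -> 0 < b ->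
  injective_path (fun t => f (b * t)) 1.
Proof.
move=> [b0 fc finj] bgt0; split; first exact: ler01.
  move=> t; apply: (@continuous_comp _ _ _ (fun t => b * t) f); last exact: fc.
  by apply: continuousM; [exact: cst_continuous|].
move=> s t /andP[s0 s1] /andP[t0 t1] /finj h.
apply: (mulfI (lt0r_neq0 bgt0)); apply: h; apply/andP; split.
- exact: mulr_ge0.
- by rewrite -[leRHS]mulr1 ler_wpM2l.
- exact: mulr_ge0.
- by rewrite -[leRHS]mulr1 ler_wpM2l.
Qed.

Lemma injective_path_rev f (b : R) : injective_path f b ->
  injective_path (fun t => f (b - t)) b.
Proof.
move=> [b0 fc finj]; split => //.
  move=> t; apply: (@continuous_comp _ _ _ (fun t => b - t) f); last exact: fc.
  by apply: continuousB; [exact: cst_continuous|].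
move=> s t /andP[s0 s1] /andP[t0 t1] /finj h.
by apply: oppr_inj; apply: (addrI b); apply: h; apply/andP; split; lra.
Qed.

(** The hypothesis on f and g says that the two images meet only at the common
    endpoint. *)
Lemma injective_path_cat f g (b c : R) : injective_path f b -> injective_path g c ->
  f b = g 0 ->
  (forall s t, 0 <= s <= b -> 0 <= t <= c -> f s = g t -> t = 0) ->
  injective_path (fun t => if t <= b then f t else g (t - b)) (b + c).
Proof.
move=> [b0 fc finj] [c0 gc ginj] fg meet; split; first exact: addr_ge0.
  have gsc : continuous (fun t => g (t - b)).
    move=> t; apply: (@continuous_comp _ _ _ (fun t => t - b) g); last exact: gc.
    by apply: continuousB; [|exact: cst_continuous].
  set h := fun t => _.
  suff : {within `]-oo, b] `|` `[b, +oo[, continuous h}.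
    have -> : (`]-oo, b] `|` `[b, +oo[)%classic = [set: R].
      apply/seteqP; split=> // t _; rewrite /= !in_itv /= andbT.
      by case: (leP t b) => [|/ltW]; [left|right].
    by move=> /(continuous_subspace_setT h).2.
  apply: withinU_continuous; [exact: lray_closed|exact: rray_closed| |].
    apply: (@subspace_eq_continuous _ _ _ f); last exact: continuous_subspaceT.
    move=> t; change (t \in `]-oo, b]%classic -> f t = h t).
    by rewrite inE /= in_itv /h /= => ->.
  apply: (@subspace_eq_continuous _ _ _ (fun t => g (t - b))); last exact: continuous_subspaceT.
  move=> t; change (t \in `[b, +oo[%classic -> g (t - b) = h t).
  rewrite inE /= in_itv /h /= andbT le_eqVlt => /orP[/eqP<-|bt].
    by rewrite lexx subrr.
  by rewrite leNgt bt.
move=> s t /andP[s0 sbc] /andP[t0 tbc].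
have [sb|bs] := leP s b; have [tb|bt] := leP t b.
- by apply: finj; apply/andP; split.
- by move=> /meet h; have := h; rewrite s0 sb => /(_ isT); lra.
- by move=> /esym/meet h; have := h; rewrite t0 tb => /(_ isT); lra.
- by move=> /ginj h; apply: (subIr b); apply: h; apply/andP; split; lra.
Qed.

Hypothesis X_uac : uniquely_arcwise_connected X.

(** The form in which uniqueness of arcs is used: cutting, reversing and gluing
    injective paths becomes cutting, reversing and gluing arcs. *)
Lemma arcE f (b : R) : injective_path f b -> arc (f 0) (f b) = f @` `[0, b].
Proof.
move=> fP; have [b0 _ finj] := fP.
have [b_eq|b_neq] := eqVneq b 0.
  rewrite b_eq; apply/seteqP; split=> [z [[_ ->]|[h [[_ _ hinj] h0 h1 _]]]|_ [t + <-]].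
  - by exists 0 => //; rewrite segmentE lexx.
  - suff /eqP : (1 : R) = 0 by rewrite oner_eq0.
    by apply: hinj; rewrite ?lexx ?ler01 // h0.
  - rewrite segmentE => t0; have -> : t = 0 by apply/eqP; rewrite eq_le andbC.
    by left.
have bgt0 : 0 < b by rewrite lt_neqAle eq_sym b_neq.
have sP := injective_path_scale fP bgt0.
apply/seteqP; split=> [z [[f0b _]|[h [hP h0 h1 [t t01 ->]]]]|_ [t + <-]].
- by move: b_neq; rewrite (finj _ _ _ _ f0b) ?eqxx // ?lexx ?b0.
- have neq : f 0 <> f b.
    by move=> /finj e; move: b_neq; rewrite e ?eqxx // ?lexx ?b0.
  have [A [_ Auniq]] := X_uac neq.
  have hA := arc_connecting_injective_path hP; rewrite h0 h1 in hA.
  have := arc_connecting_injective_path sP; rewrite mulr0 mulr1.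
  move=> /Auniq sA; rewrite (Auniq _ hA) in sA.
  have : (h @` `[0, 1]) (h t) by exists t => //; rewrite segmentE.
  rewrite sA => -[s]; rewrite segmentE => /andP[s0 s1] <-.
  exists (b * s) => //; rewrite segmentE mulr_ge0 //=.
  by rewrite -[leRHS]mulr1 ler_wpM2l.
- rewrite segmentE => /andP[t0 tb]; right.
  exists (fun t => f (b * t)); rewrite mulr0 mulr1; split=> //.
  exists (t / b); last by rewrite mulrCA divff ?mulr1.
  by rewrite divr_ge0 // ler_pdivrMr // mul1r.
Qed.

Lemma arc_pathP x y : exists f (b : R), [/\ injective_path f b, f 0 = x & f b = y].
Proof.
have [<-|xy] := pselect (x = y).
  exists (cst x), 0; split=> //; split=> //; first exact: cst_continuous.
  by move=> s t; rewrite -!eq_le => /eqP<- /eqP<-.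
have [A [/injective_path_of_arc[f [fP f0 f1 _]] _]] := X_uac xy.
by exists f, 1.
Qed.

Lemma arc_split f (b s : R) : injective_path f b -> 0 <= s <= b ->
  arc (f 0) (f s) = f @` `[0, s] /\ arc (f s) (f b) = f @` `[s, b].
Proof.
move=> fP /andP[s0 sb]; split.
  have := injective_path_affine fP (lexx 0) s0 sb.
  rewrite subr0 => /arcE; rewrite !add0r => ->.
  by apply: eq_imagel => t _; rewrite add0r.
have := injective_path_affine fP s0 sb (lexx b) => /arcE.
rewrite addr0 subrKC => ->; apply/seteqP; split=> _ [t + <-]; rewrite segmentE => /andP[t0 tb].
  by exists (s + t) => //; rewrite segmentE; apply/andP; split; lra.
exists (t - s); last by rewrite subrKC.
by rewrite segmentE; apply/andP; split; lra.
Qed.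

Lemma arc_sym x y : arc x y = arc y x.
Proof.
have [f [b [fP <- <-]]] := arc_pathP x y.
rewrite (arcE fP); have := arcE (injective_path_rev fP).
rewrite subr0 subrr => ->; apply/seteqP; split=> _ [t + <-]; rewrite segmentE => /andP[t0 tb];
  exists (b - t); rewrite ?segmentE ?opprB ?subrKC //; apply/andP; split; lra.
Qed.

Lemma arc_left x y : arc x y x.
Proof.
have [f [b [fP <- <-]]] := arc_pathP x y; rewrite (arcE fP).
by exists 0 => //; rewrite segmentE lexx; case: fP.
Qed.

Lemma arc_right x y : arc x y y.
Proof. by rewrite arc_sym; exact: arc_left. Qed.

Lemma arcxx x : arc x x = [set x].
Proof.
have P : injective_path (cst x) 0.
  split=> //; first exact: cst_continuous.
  by move=> s t; rewrite -!eq_le => /eqP<- /eqP<-.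
have := arcE P; rewrite /= => ->; apply/seteqP; split=> [_ [t _ <-]|_ ->] //.
by exists 0 => //; rewrite segmentE lexx.
Qed.

Lemma arc_compact x y : compact (arc x y).
Proof.
have [f [b [fP <- <-]]] := arc_pathP x y; rewrite (arcE fP).
exact: injective_path_compact fP.
Qed.

Lemma arc_closed x y : closed (arc x y).
Proof. by apply: metric_closed; exact: arc_compact. Qed.

Lemma arcP x y z : arc x y z -> exists f (b s : R),
  [/\ injective_path f b, 0 <= s <= b, f 0 = x, f b = y & f s = z].
Proof.
have [f [b [fP <- <-]]] := arc_pathP x y.
by rewrite (arcE fP) => -[s]; rewrite segmentE => sb <-; exists f, b, s.
Qed.

Lemma arc_anti x y z : arc x z y -> arc x y z -> y = z.
Proof.
move=> /arcP[f [b [s [fP sb <- <- <-]]]]; rewrite (arc_split fP sb).1 => -[t].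
have [_ _ finj] := fP; move: sb => /andP[s0 sb].
rewrite segmentE => /andP[t0 ts] /finj tE.
have e : t = b by apply: tE; rewrite ?t0 ?lexx ?(le_trans ts) // (le_trans s0).
by congr f; apply/eqP; rewrite eq_le sb -e ts.
Qed.

Lemma arc_cut x y z : arc x y z -> arc x y = arc x z `|` arc z y.
Proof.
move=> /arcP[f [b [s [fP sb <- <- <-]]]]; have [-> ->] := arc_split fP sb.
rewrite (arcE fP); move: sb => /andP[s0 sb]; apply/seteqP; split.
  move=> _ [t + <-]; rewrite segmentE => /andP[t0 tb].
  have [ts|st] := leP t s; [left|right]; exists t => //; rewrite segmentE ?t0 ?ts //.
  by rewrite (ltW st).
move=> _ [] [t + <-]; rewrite segmentE => /andP[t0 tb]; exists t => //; rewrite segmentE.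
  by rewrite t0 (le_trans tb).
by rewrite tb (le_trans s0).
Qed.

Lemma arc_subl x y z : arc x y z -> arc x z `<=` arc x y.
Proof. by move=> /arc_cut ->; exact: subsetUl. Qed.

Lemma arc_subr x y z : arc x y z -> arc z y `<=` arc x y.
Proof. by move=> /arc_cut ->; exact: subsetUr. Qed.

Lemma arc_total x w y z : arc x w y -> arc x w z -> arc x z y \/ arc x y z.
Proof.
move=> /arcP[f [b [s [fP sb <- <- <-]]]]; rewrite (arcE fP) => -[t].
rewrite segmentE => tb <-; rewrite (arc_split fP sb).1 (arc_split fP tb).1.
move: sb tb => /andP[s0 sb] /andP[t0 tb].
by case: (leP s t) => [st|/ltW ts]; [left; exists s|right; exists t] => //; rewrite segmentE ?s0 ?t0.
Qed.

(** The concatenation of two arcs that meet only at their common endpoint is the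
    image of an injective path, so it is the arc between the outer endpoints. *)
Lemma arc_cat x m y : arc x m `&` arc m y `<=` [set m] ->
  arc x y = arc x m `|` arc m y.
Proof.
have [f [b [fP <- <-]]] := arc_pathP x m; have [g [c [gP]]] := arc_pathP (f b) y.
move=> fg <-; rewrite -{2 5}fg !(arcE fP) !(arcE gP) => meet.
have [b0 _ _] := fP; have [c0 _ ginj] := gP.
have catP := injective_path_cat fP gP (esym fg).
have {catP}/arcE : injective_path (fun t => if t <= b then f t else g (t - b)) (b + c).
  apply: catP => s t sb tc fst.
  apply: ginj => //; first by rewrite lexx.
  rewrite fg; apply: meet; split; last by exists t => //; rewrite segmentE.
  by exists s => //; rewrite segmentE.
have -> : (if b + c <= b then f (b + c) else g (b + c - b)) = g c.
  rewrite addrC addrK; case: ifP => // cb.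
  have -> : c = 0 by apply/eqP; rewrite eq_le c0; move: cb; rewrite gerDr => ->.
  by rewrite add0r fg.
rewrite b0 => ->; apply/seteqP; split.
  move=> _ [t + <-]; rewrite segmentE => /andP[t0 tbc].
  case: ifP => [tb|/negbT]; first by left; exists t => //; rewrite segmentE t0.
  rewrite -ltNge => bt; right; exists (t - b) => //; rewrite segmentE; apply/andP; split; lra.
move=> _ [] [t + <-]; rewrite segmentE => /andP[t0 tb].
  exists t; last by rewrite tb.
  by rewrite segmentE t0; apply: (le_trans tb); rewrite lerDl.
exists (b + t); first by rewrite segmentE; apply/andP; split; lra.
case: ifP => [|_]; last by rewrite addrAC subrr add0r.
rewrite gerDl => t0'; have -> : t = 0 by apply/eqP; rewrite eq_le t0'.
by rewrite addr0 fg.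
Qed.

(** The first point of A met on the way from x to y. *)
Lemma arc_gate (A : set X) x y : closed A -> A y ->
  exists m, [/\ A m, arc x y m & arc x m `&` A `<=` [set m]].
Proof.
move=> cA; have [f [b [fP <- <-]]] := arc_pathP x y => Ab.
have [b0 fc finj] := fP.
have [|||s sT smin] := @compact_EVT_min R R id (`[0, b] `&` f @^-1` A).
- by exists b; split=> //; rewrite segmentE b0 lexx.
- apply: compact_closedI; first exact: segment_compact.
  by move/continuous_closedP: fc; exact.
- by apply: continuous_subspaceT => u B.
move: sT; rewrite inE => -[]; rewrite segmentE => sb As.
exists (f s); split=> //; first by rewrite (arcE fP); exists s => //; rewrite segmentE.
rewrite (arc_split fP sb).1 => _ [[t + <-] Aft]; rewrite segmentE => /andP[t0 ts].
have /smin : t \in `[0, b] `&` f @^-1` A.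
  rewrite inE; split=> //; rewrite segmentE t0 (le_trans ts) //.
  by case/andP: sb.
by move=> st; congr f; apply/eqP; rewrite eq_le ts.
Qed.

(** The gate m of y on the arc from x to z is a median, because the arc from y to m
    meets the arcs from m to x and from m to z only at m. *)
Lemma arc_median x y z : exists m, [/\ arc x y m, arc y z m & arc x z m].
Proof.
have [m [Am ym mA]] := arc_gate y (@arc_closed x z) (arc_left x z).
have cut := arc_cut Am.
exists m; split=> //; first by rewrite arc_sym.
rewrite (@arc_cat y m z); first by left; exact: arc_right.
by move=> u [ymu mzu]; apply: mA; split=> //; rewrite cut; right.
Qed.

Lemma arc_tripod x y z : arc x z `<=` arc x y `|` arc y z.
Proof.
have [m [xym yzm xzm]] := arc_median x y z.
rewrite (arc_cut xzm) => u [xmu|mzu]; [left|right].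
  exact: arc_subl xmu.
exact: arc_subr mzu.
Qed.

Lemma arc_chain_sup x z (T : set X) : T !=set0 -> T `<=` arc x z ->
  exists p, [/\ closure T p, arc x z p & T `<=` arc x p].
Proof.
have [f [b [fP <- <-]]] := arc_pathP x z; rewrite (arcE fP) => -[u Tu] TA.
have [b0 fc _] := fP.
pose S := `[0, b] `&` f @^-1` T.
have S0 : S !=set0 by have [s sb fsu] := TA _ Tu; exists s; split; rewrite // /preimage /= fsu.
have Sub : has_ubound S by exists b => s []; rewrite segmentE => /andP[].
pose s := sup S.
have [t St] := S0; have st := ub_le_sup Sub St; have sb : s <= b.
  by apply: ge_sup => // t' []; rewrite segmentE => /andP[].
have s0b : 0 <= s <= b.
  by rewrite sb andbT (le_trans _ st) //; case: St; rewrite segmentE => /andP[].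
exists (f s); split.
- move=> B /fc fB; have [t' [[_ Tt'] Bt']] := closure_sup S0 Sub fB.
  by exists (f t').
- by exists s => //; rewrite segmentE.
- rewrite (arc_split fP s0b).1 => v Tv; have [t' t'b fv] := TA _ Tv.
  exists t' => //; rewrite segmentE; apply/andP; split.
    by move: t'b; rewrite segmentE => /andP[].
  by apply: ub_le_sup => //; split=> //; rewrite /preimage /= fv.
Qed.

(** A sequence converging to x along the arc to y, so that it eventually enters
    every nondegenerate initial segment. *)
Lemma arc_germ x y : x <> y -> exists q : nat -> X,
  [/\ forall n, q n <> x, forall n, arc x y (q n),
      forall n k, (n <= k)%N -> arc x (q n) (q k) &
      forall m, arc x y m -> m <> x -> exists n, arc x m (q n)].
Proof.
have [f [b [fP <- <-]]] := arc_pathP x y => neq.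
have [b0 fc finj] := fP.
have bgt0 : 0 < b.
  by rewrite lt_neqAle b0 andbT; apply/eqP => b_eq; apply: neq; rewrite -b_eq.
pose r n : R := b / n.+1%:R.
have r0 n : 0 < r n by rewrite divr_gt0.
have rb n : 0 <= r n <= b.
  by rewrite ltW //= ler_pdivrMr // ler_peMr // ler1n.
have rmono n k : (n <= k)%N -> r k <= r n.
  by move=> nk; rewrite ler_pM2l // lef_pV2 ?posrE // ler_nat ltnS.
exists (f \o r); split=> [n /finj|n|n k nk|m] /=.
- by rewrite lexx b0 => /(_ (rb n) isT); apply/eqP; rewrite gt_eqF.
- by rewrite (arcE fP); exists (r n) => //; rewrite segmentE.
- rewrite (arc_split fP (rb n)).1; exists (r k) => //; rewrite segmentE rmono //.
  by rewrite ltW.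
- rewrite (arcE fP) => -[t]; rewrite segmentE => tb <- ft0; rewrite (arc_split fP tb).1.
  have tgt0 : 0 < t.
    case/andP: tb => t0 _; rewrite lt_neqAle t0 andbT; apply/eqP => t_eq.
    by apply: ft0; rewrite -t_eq.
  exists (Num.trunc (b / t)); exists (r (Num.trunc (b / t))) => //.
  rewrite segmentE ltW //= ler_pdivrMr // mulrC -ler_pdivrMr //.
  by apply/ltW; rewrite truncnS_gt.
Qed.

Lemma arc_homeo (h : X -> X) x y z : continuous h -> injective h ->
  arc x y z -> arc (h x) (h y) (h z).
Proof.
move=> hc hinj /arcP[f [b [s [[b0 fc finj] sb <- <- <-]]]].
have hP : injective_path (h \o f) b.
  split=> //; first by move=> t; apply: (continuous_comp (fc t)); exact: hc.
  by move=> t t' tb tb' /hinj; exact: finj.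
by have := arcE hP; rewrite /= => ->; exists s => //; rewrite segmentE.
Qed.

End Arcs.

(** * Closed conditions *)

Lemma exists_inv_natS_lt (R : realType) (e : R) : 0 < e ->
  exists k, k.+1%:R^-1 < e.
Proof.
move=> e0; exists (Num.trunc e^-1).
by rewrite -ltf_pV2 ?posrE ?invr_gt0 // invrK truncnS_gt.
Qed.

Section ClosedSets.
Context {T : topologicalType}.

Lemma closed_forall (I : Type) (P : I -> T -> Prop) :
  (forall i, closed [set z | P i z]) -> closed [set z | forall i, P i z].
Proof.
move=> cP z clz i; apply: (cP i) => B Bz.
by have [w [Pw Bw]] := clz B Bz; exists w; split=> //; exact: Pw.
Qed.

Lemma closed_impl (A : Prop) (P : T -> Prop) :
  closed [set z | P z] -> closed [set z | A -> P z].
Proof. by move=> cP; apply: (@closed_forall A (fun=> P)) => _. Qed.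

Lemma closed_or (P Q : T -> Prop) : closed [set z | P z] -> closed [set z | Q z] ->
  closed [set z | P z \/ Q z].
Proof. by move=> cP cQ; apply: closedU. Qed.

Lemma closed_and (P Q : T -> Prop) : closed [set z | P z] -> closed [set z | Q z] ->
  closed [set z | P z /\ Q z].
Proof. by move=> cP cQ; apply: closedI. Qed.

Lemma closed_cst_prop (A : Prop) : closed [set _ : T | A].
Proof.
have [HA|nA] := pselect A.
  rewrite (_ : [set _ | _] = setT); first exact: closedT.
  by apply/seteqP; split.
rewrite (_ : [set _ | _] = set0); first exact: closed0.
by apply/seteqP; split.
Qed.

Context {R : realType}.

Lemma closed_fun_le (phi : T -> R) c : continuous phi -> closed [set z | phi z <= c].
Proof. by move=> /continuous_closedP/(_ _ (@closed_le R c)). Qed.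

Lemma closed_fun_ge (phi : T -> R) c : continuous phi -> closed [set z | c <= phi z].
Proof. by move=> /continuous_closedP/(_ _ (@closed_ge R c)). Qed.

Context {X : metricType R}.

Lemma mdist_continuous (phi psi : T -> X) : continuous phi -> continuous psi ->
  continuous (fun t => mdist (phi t) (psi t)).
Proof.
move=> cphi cpsi t; apply/cvgrPdist_lt => e e0.
have e20 : 0 < e / 2 by rewrite divr_gt0.
have /metricType_numDomainType.cvgrPdist_lt/(_ _ e20) h1 := cphi t.
have /metricType_numDomainType.cvgrPdist_lt/(_ _ e20) h2 := cpsi t.
near=> s.
have d1 : mdist (phi t) (phi s) < e / 2 by near: s.
have d2 : mdist (psi t) (psi s) < e / 2 by near: s.
have t1 := metric_triangle (phi t) (phi s) (psi t).
have t2 := metric_triangle (phi s) (psi s) (psi t).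
have t3 := metric_triangle (phi s) (phi t) (psi s).
have t4 := metric_triangle (phi t) (psi t) (psi s).
rewrite (metric_sym (phi s) (phi t)) in t3.
rewrite (metric_sym (psi s) (psi t)) in t2.
by rewrite ltr_norml; apply/andP; split; lra.
Unshelve. all: by end_near. Qed.

Lemma closed_fun_eq (phi : T -> X) y : continuous phi -> closed [set z | phi z = y].
Proof.
have : closed [set y].
  by apply: accessible_closed_set1; exact/hausdorff_accessible/metric_hausdorff.
by move=> cy /continuous_closedP/(_ _ cy).
Qed.

(** Uniform continuity and uniform injectivity of a path are the two cases in which
    phi and psi are the distances of the parameters and of the values, in one
    order or the other. *)
Lemma compact_modulus (K : set T) (phi psi : T -> R) e : compact K ->
  continuous phi -> continuous psi -> (forall z, K z -> phi z <= 0 -> psi z < e) ->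
  exists n, forall z, K z -> n.+1%:R^-1 <= phi z \/ psi z <= e.
Proof.
move=> kK cphi cpsi H; apply: contrapT => nex.
pose C n := [set z | phi z <= n.+1%:R^-1 /\ e <= psi z].
have [n|n m nm z [h1 h2]|n|z [Kz Cz]] := compact_nested (C := C) kK.
- by apply: closed_and; [exact: closed_fun_le|exact: closed_fun_ge].
- by split=> //; apply: le_trans h1 _; rewrite lef_pV2 ?posrE // ler_nat ltnS.
- apply: contrapT => KC; apply: nex; exists n => z Kz.
  have [|h1] := leP n.+1%:R^-1 (phi z); first by left.
  right; rewrite leNgt; apply/negP => h2; apply: KC; exists z; split=> //.
  by split; exact: ltW.
- have : psi z < e.
    apply: H => //; rewrite leNgt; apply/negP => phi0.
    have [n ltn] := exists_inv_natS_lt phi0; have [+ _] := Cz n I.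
    by rewrite leNgt ltn.
  by have [_ +] := Cz 0%N I; rewrite leNgt => /negP.
Qed.

End ClosedSets.

(** * Shadows are measurable *)

Section Shadow.
Context {R : realType} {X : metricType R} {mu : set X -> R}.
Hypotheses (X_compact : compact [set: X]) (X_uac : uniquely_arcwise_connected X).
Hypothesis muP : regular_capacity mu.

Definition shadow (x y : X) : set X := [set z | arc y z x].

(* The topology of pointwise convergence makes the space of all functions compact,
   and the conditions on paths used below are closed for it. *)
Let Z := (prod_topology (fun _ : R => X)).

Let Z_compact : compact [set: Z].
Proof.
have -> : [set: Z] = [set f : Z | forall t, [set: X] (f t)] by apply/seteqP; split.
exact: (@tychonoff R (fun=> X) (fun=> setT)).
Qed.

Let ev_continuous (t : R) : continuous (fun f : Z => f t).
Proof. exact: (@proj_continuous R (fun=> X) t). Qed.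

(** A modulus of continuity and a modulus of injectivity at scale 1 / k.+1, written
    with disjunctions of weak inequalities so that it is closed under pointwise
    limits, also when u varies. *)
Definition modulus (k n : nat) (f : R -> X) : Prop :=
  forall u v : R, 0 <= u <= 1 -> 0 <= v <= 1 ->
    (n.+1%:R^-1 <= `|u - v| \/ mdist (f u) (f v) <= k.+1%:R^-1) /\
    (n.+1%:R^-1 <= mdist (f u) (f v) \/ `|u - v| <= k.+1%:R^-1).

Let modulus_closed k n (T : topologicalType) (p : T -> Z) : continuous p ->
  closed [set z | modulus k n (p z)].
Proof.
move=> cp; apply: closed_forall => u; apply: closed_forall => v.
have cpt t : continuous (fun z => p z t).
  by move=> z; apply: (@continuous_comp _ _ _ p (fun f : Z => f t)); [exact: cp|exact: ev_continuous].
do 2 apply: closed_impl; apply: closed_and; apply: closed_or;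
  try exact: closed_cst_prop.
- by apply: closed_fun_le; exact: mdist_continuous.
- by apply: closed_fun_ge; exact: mdist_continuous.
Qed.

Lemma modulus_mono k n m f : (n <= m)%N -> modulus k n f -> modulus k m f.
Proof.
move=> nm fP u v u01 v01.
have le_inv : m.+1%:R^-1 <= n.+1%:R^-1 :> R by rewrite lef_pV2 ?posrE // ler_nat ltnS.
by have [[?|?] [?|?]] := fP u v u01 v01; split; (try by left; exact: le_trans le_inv _); right.
Qed.

Lemma injective_path_modulus f k : injective_path f 1 -> exists n, modulus k n f.
Proof.
move=> [_ fc finj].
have kK : compact (`[0, 1]%classic `*` `[0, 1]%classic : set (R * R)).
  by apply: compact_setX; exact: segment_compact.
have c1 : continuous (fun z : R * R => `|z.1 - z.2|).
  move=> z; apply: (@continuous_comp _ _ _ (fun z : R * R => z.1 - z.2) Num.norm);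
    last exact: norm_continuous.
  by apply: continuousB; [exact: cvg_fst|exact: cvg_snd].
have c2 : continuous (fun z : R * R => mdist (f z.1) (f z.2)).
  apply: mdist_continuous => z.
    by apply: (@continuous_comp _ _ _ fst f); [exact: cvg_fst|exact: fc].
  by apply: (@continuous_comp _ _ _ snd f); [exact: cvg_snd|exact: fc].
have k0 : 0 < k.+1%:R^-1 :> R by rewrite invr_gt0.
have [|n1 n1P] := compact_modulus (e := k.+1%:R^-1) kK c1 c2.
  by move=> [u v] /= _; rewrite normr_le0 subr_eq0 => /eqP->; rewrite mdistxx.
have [|n2 n2P] := compact_modulus (e := k.+1%:R^-1) kK c2 c1.
  move=> [u v] [/=]; rewrite !in_itv /= => u01 v01 d0.
  suff -> : u = v by rewrite subrr normr0.
  by apply: finj => //; apply: mdist_positivity; apply/eqP; rewrite eq_le d0 mdist_ge0.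
exists (maxn n1 n2) => u v u01 v01.
have Kuv : (`[0, 1]%classic `*` `[0, 1]%classic : set (R * R)) (u, v).
  by split; rewrite /= in_itv.
have le1 : (maxn n1 n2).+1%:R^-1 <= n1.+1%:R^-1 :> R.
  by rewrite lef_pV2 ?posrE // ler_nat ltnS leq_maxl.
have le2 : (maxn n1 n2).+1%:R^-1 <= n2.+1%:R^-1 :> R.
  by rewrite lef_pV2 ?posrE // ler_nat ltnS leq_maxr.
by split; [have [/= ?|?] := n1P _ Kuv|have [/= ?|?] := n2P _ Kuv];
  [left; exact: le_trans le1 _|right|left; exact: le_trans le2 _|right].
Qed.

Lemma modulus_injective_path f (s : nat -> nat) : (forall k, modulus k (s k) f) ->
  injective_path (f \o unit_clamp) 1.
Proof.
move=> fP; apply: injective_path_clamp.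
  apply/subspace_continuousP => u; rewrite segmentE => u01.
  apply/metricType_numDomainType.cvgrPdist_lt => e e0.
  have [k ke] : exists k, k.+1%:R^-1 < e.
    exact: exists_inv_natS_lt.
  rewrite near_withinE; near=> v; rewrite segmentE => v01.
  have [[h|/le_lt_trans->//] _] := fP k u v u01 v01.
  suff : `|u - v| < (s k).+1%:R^-1 by rewrite ltNge h.
  by near: v; apply: cvgr_dist_lt; rewrite ?invr_gt0 //; exact: cvg_id.
move=> u v u01 v01 fuv; apply/eqP; rewrite -subr_eq0 -normr_le0 leNgt; apply/negP => d0.
have [k ke] : exists k, k.+1%:R^-1 < `|u - v|.
  exact: exists_inv_natS_lt.
have [_ [|]] := fP k u v u01 v01.
  by rewrite fuv mdistxx leNgt invr_gt0 ltr0n.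
by rewrite leNgt ke.
Unshelve. all: by end_near. Qed.

(** The arcs issued from y are a K-sigma-delta set of functions, because a function
    parametrizes an arc when it has some modulus at every scale.  Capacitability
    bounds these moduli on a set of endpoints of almost full capacity, and among
    arcs with bounded moduli passing through x is a closed condition. *)
Lemma shadow_measurable x y : capacity_measurable mu (shadow x y).
Proof.
have [xy|xy] := pselect (x = y).
  have -> : shadow x y = setT.
    by apply/seteqP; split=> // z _; rewrite /shadow /= xy; exact: arc_left.
  exact/(capacity_measurable_open muP)/openT.
apply: (capacity_measurable_approx muP) => c c1.
(* The alternative f 1 = y accounts for the endpoint y itself, to which no
   nondegenerate arc leads. *)
pose C k n : set Z := [set f | f 0 = y /\ (f 1 = y \/ modulus k n f)].
have C_closed k n : closed (C k n).
  apply: closed_and; first exact/closed_fun_eq/ev_continuous.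
  apply: closed_or; first exact/closed_fun_eq/ev_continuous.
  by apply: (@modulus_closed _ _ Z id) => z.
have C_mono k n m : (n <= m)%N -> C k n `<=` C k m.
  by move=> nm f [f0 [f1|/(modulus_mono nm)]]; split=> //; [left|right].
have C_onto : (fun f : Z => f 1) @` (\bigcap_k \bigcup_n C k n) = setT.
  apply/seteqP; split=> // z _.
  have [zy|zy] := pselect (y = z).
    by exists (cst y) => // k _; exists 0%N => //; split=> //; left.
  have [A [/injective_path_of_arc[f [fP f0 f1 _]] _]] := X_uac zy.
  exists f => // k _; have [n nP] := injective_path_modulus k fP.
  by exists n => //; split=> //; right.
have [|s cs] := capacitability muP Z_compact (@ev_continuous 1) C_closed C_mono (c := c).
  by rewrite C_onto (capacityT muP).
have img_closed (T : topologicalType) (p : T -> Z) (K F : set T) : compact K ->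
    closed F -> continuous p -> closed ((fun z => p z 1) @` (K `&` F)).
  move=> kK cF cp; apply: compact_closed; first exact: metric_hausdorff.
  apply: continuous_compact; last exact: compact_closedI.
  apply: continuous_subspaceT => z.
  by apply: (@continuous_comp _ _ _ p (fun f : Z => f 1)); [exact: cp|exact: ev_continuous].
exists ((fun f : Z => f 1) @` (\bigcap_k C k (s k))); split=> //.
  rewrite -[X in _ @` X]setTI; apply: (img_closed Z id) => //.
    by apply: closed_bigI => k _; exact: C_closed.
  by move=> z.
(* The pairs of an arc and a parameter u at which it goes through x.  The equation
   f u = x is not closed for pointwise convergence when u varies; the modulus of
   continuity turns it into closed conditions on the values f v. *)
pose Q : set (Z * R) := [set fu | fu.1 0 = y /\ (forall k,
  modulus k (s k) fu.1 /\ forall v : R, 0 <= v <= 1 ->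
   ((s k).+1%:R^-1 <= `|fu.2 - v| \/ mdist (fu.1 v) x <= k.+1%:R^-1))].
have -> : shadow x y `&` (fun f : Z => f 1) @` (\bigcap_k C k (s k)) =
    (fun fu : Z * R => fu.1 1) @` (([set: Z] `*` `[0, 1]%classic) `&` Q).
  apply/seteqP; split=> [z [Sz [f Cf fz]]|w [[f u] [[/= _]]]].
    rewrite -{z}fz in Sz *; have [f0 _] := Cf 0%N I.
    have fP k : modulus k (s k) f.
      have [_ [f1|//]] := Cf k I.
      by move: Sz; rewrite /shadow /= f1 (arcxx X_uac) => /xy.
    have gP := modulus_injective_path fP.
    have := arcE X_uac gP; rewrite /= !unit_clamp_id ?lexx ?ler01 // f0 => arcE.
    move: Sz; rewrite /shadow /= arcE => -[u u01]; move: (u01); rewrite segmentE => u01'.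
    rewrite /= unit_clamp_id // => fu; exists (f, u) => //; split=> //; split=> // k.
    by split=> // v v01; have [+ _] := fP k u v u01' v01; rewrite /= fu metric_sym.
  rewrite in_itv /= => u01 [/= f0 fP] <-.
  have gP := modulus_injective_path (fun k => (fP k).1).
  split; last by exists f => // k _; split=> //; right; exact: (fP k).1.
  have := arcE X_uac gP; rewrite /= !unit_clamp_id ?lexx ?ler01 // f0 /shadow /= => ->.
  exists u; rewrite ?segmentE //= unit_clamp_id //.
  apply: mdist_positivity; apply/eqP; rewrite eq_le mdist_ge0 andbT leNgt; apply/negP => d0.
  have [k ke] : exists k, k.+1%:R^-1 < mdist (f u) x.
    exact: exists_inv_natS_lt.
  have [_ /(_ u u01)] := fP k; rewrite subrr normr0 leNgt invr_gt0 ltr0n /= => -[//|].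
  by rewrite leNgt ke.
have fst_continuous : continuous (@fst Z R) by move=> z; exact: cvg_fst.
apply: (img_closed _ (@fst Z R)) => //.
  by apply: compact_setX => //; exact: segment_compact.
have ev_fst t : continuous (fun fu : Z * R => fu.1 t).
  move=> z; apply: (@continuous_comp _ _ _ (@fst Z R) (fun f : Z => f t)).
    exact: fst_continuous.
  exact: ev_continuous.
apply: closed_and; first exact: closed_fun_eq.
apply: closed_forall => k; apply: closed_and; first exact: modulus_closed.
apply: closed_forall => v; apply: closed_impl; apply: closed_or.
  apply: closed_fun_ge => z.
  apply: (@continuous_comp _ _ _ (fun fu : Z * R => fu.2 - v) Num.norm);
    last exact: norm_continuous.
  by apply: continuousB; [exact: cvg_snd|exact: cst_continuous].
apply: closed_fun_le; apply: mdist_continuous => //.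
by move=> z; exact: cst_continuous.
Qed.

End Shadow.

(** * Center of mass *)

Lemma compact_metric_separable (R : realType) (X : metricType R) (T : set X) :
  compact [set: X] -> T !=set0 ->
  exists d : nat -> X, (forall n, T (d n)) /\
    forall t U, T t -> open U -> U t -> exists n, U (d n).
Proof.
move=> kX [t0 Tt0].
(* A base point is needed to speak of second countability. *)
pose X' : pseudoPMetricType R := HB.pack (X : Type) X (isPointed.Build X t0).
have [B /countable_injP[f finj] [Bo Bb]] := @compact_second_countable R X' kX.
pose P n := exists t, T t /\ exists2 b, B b /\ f b = n & b t.
pose d n := if pselect (P n) is left e then sval (cid e) else t0.
exists d; split.
  by move=> n; rewrite /d; case: pselect => // e; case: cid => t [].
move=> t U Tt oU Ut.
have [b [Bx bt] bU] := Bb t U (open_nbhs_nbhs (conj oU Ut)).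
exists (f b); apply: bU; rewrite /d; case: pselect => [e|[]].
  case: cid => t' /= [_ [b' [Bb' fb'] b't']].
  by rewrite -(finj b' b) // inE.
by exists t; split=> //; exists b.
Qed.

Section Endgame.
Context {R : realType} {X : metricType R} {mu : set X -> R}.
Hypotheses (X_compact : compact [set: X]) (X_uac : uniquely_arcwise_connected X).
Hypothesis muP : regular_capacity mu.

Let shadowM x y : capacity_measurable mu (shadow x y).
Proof. exact: shadow_measurable. Qed.

Let anti := arc_anti X_uac.
Let sym := arc_sym X_uac.

Lemma arc_btw (x p q z : X) : arc x z p -> arc p z q -> arc x q p.
Proof.
move=> xzp pzq; have xzq := arc_subr X_uac xzp pzq.
have := xzp; rewrite (arc_cut X_uac xzq) => -[//|qzp].
rewrite (anti (x := z) (y := p) (z := q)) ?[arc z _]sym //.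
exact: arc_right.
Qed.

(** Two arcs that overlap in a nondegenerate arc glue to an arc. *)
Lemma arc_extend (x p q w : X) : p <> q -> arc x q p -> arc p w q -> arc x w q.
Proof.
move=> pq xqp /(@arc_tripod _ _ X_uac p x w)[pxq|//].
by case: pq; apply: (anti xqp); rewrite sym.
Qed.

Lemma shadow_anti (x y z : X) : x <> y -> shadow x y z -> shadow y x z -> False.
Proof.
by move=> xy yzx xzy; apply: xy; apply: (anti (x := z)); rewrite sym.
Qed.

Lemma shadow_sub (x p q : X) : arc x q p -> shadow q x `<=` shadow p x.
Proof. by move=> xqp z xzq; exact: (arc_subl X_uac xzq). Qed.

Lemma shadowxx x : mu (shadow x x) = 1.
Proof.
rewrite -(capacityT muP); congr mu; apply/seteqP; split=> // z _.
exact: (arc_left X_uac).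
Qed.

Let chain (x : X) (T : set X) :=
  forall y y', T y -> T y' -> arc x y' y \/ arc x y y'.

(** The substitute for the convergence of rays.  Along a chain without largest
    element a cofinal sequence exists by separability, and the shadows along it
    decrease to a set of capacity at least 1/2.  A point of that set is joined
    to x by an arc containing the whole chain, and the supremum of the chain in
    that arc is p. *)
Lemma shadow_landing x (T : set X) : T !=set0 -> chain x T ->
  (forall y, T y -> 2^-1 <= mu (shadow y x)) ->
  exists p, [/\ T `<=` arc x p & 2^-1 <= mu (shadow p x)].
Proof.
move=> T0 chT muT.
have [[y Ty TA]|nomax] := pselect (exists2 y, T y & T `<=` arc x y).
  by exists y; split=> //; exact: muT.
have [d [Td dense]] := compact_metric_separable X_compact T0.
(* The running maxima of the dense sequence d for the order of the chain. *)
pose e := fix e n := if n is k.+1 then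
  (if pselect (arc x (d k.+1) (e k)) then d k.+1 else e k) else d 0%N.
have Te n : T (e n) by elim: n => [|n IH] /=; [exact: Td|case: pselect => h; [exact: Td|exact: IH]].
have eS n : arc x (e n.+1) (e n).
  by rewrite /=; case: pselect => h //; exact: (arc_right X_uac).
have ed n : arc x (e n) (d n).
  case: n => [|n]; first exact: (arc_right X_uac).
  rewrite /=; case: pselect => [h|nd]; first exact: (arc_right X_uac).
  by have [] := chT _ _ (Te n) (Td n.+1).
have emono n m : (n <= m)%N -> arc x (e m) (e n).
  elim: m => [|m IH]; first by rewrite leqn0 => /eqP->; exact: (arc_right X_uac).
  rewrite leq_eqVlt => /orP[/eqP->|]; first exact: (arc_right X_uac).
  by move=> /IH; exact: (arc_subl X_uac (eS m)).
have cofinal y : T y -> exists n, arc x (e n) y.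
  move=> Ty; apply: contrapT => ncof; apply: nomax; exists y => // y' Ty'.
  apply: contrapT => ny'.
  have [n ndn] := dense y' _ Ty' (closed_openC (arc_closed X_uac (x := x) (y := y))) ny'.
  apply: ncof; exists n; apply: (arc_subl X_uac (ed n)).
  by have [|//] := chT _ _ Ty (Td n).
have cap_ge : 2^-1 <= mu (\bigcap_n shadow (e n) x).
  apply: (capacity_above muP) => [n m nm|n|n]; [|exact: shadowM|exact: muT].
  exact/shadow_sub/emono.
have [z Az] : \bigcap_n shadow (e n) x !=set0.
  apply/set0P/eqP => A0; move: cap_ge; rewrite A0 (capacity0 muP).
  by rewrite leNgt invr_gt0 ltr0n.
have subA w : (\bigcap_n shadow (e n) x) w -> T `<=` arc x w.
  by move=> Aw y /cofinal[n]; apply: (arc_subl X_uac); exact: Aw.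
have [p [clp _ Tp]] := arc_chain_sup X_uac T0 (subA z Az).
exists p; split=> //; apply: (le_trans cap_ge); apply: (capacity_le muP) => w /subA Tw.
by apply: (arc_closed X_uac); exact: closure_subset clp.
Qed.

(** The center of mass of nu; on a finite tree these are the medians of nu, which
    form a vertex or a path. *)
Definition central_points (nu : set X -> R) : set X :=
  [set x | forall y, 2^-1 <= nu (shadow x y)].

Local Notation central := (central_points mu).

(** If the branch of x towards y has mass more than 1/2, then so has the shadow of a
    point q close enough to x on the arc to y, because these shadows exhaust the
    branch. *)
Lemma heavy_germ x : ~ central x -> exists2 q, q <> x & 2^-1 < mu (shadow q x).
Proof.
move=> /existsNP[y /negP]; rewrite -ltNge => lt_half.
have xy : x <> y by move=> xy; move: lt_half; rewrite -xy shadowxx; lra.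
have [q [qx xyq qmono qcof]] := arc_germ X_uac xy.
have sub : ~` shadow x y `<=` \bigcup_n shadow (q n) x.
  move=> z nyzx; have [m [xym yzm xzm]] := arc_median X_uac x y z.
  have [|n xmq] := qcof m xym; first by move=> mx; apply: nyzx; rewrite /shadow /= -mx.
  by exists n => //; exact: (arc_subl X_uac xzm).
have [n k nk|/=|n lt_mu] := capacity_below muP (A := fun n => shadow (q n) x) (c := 2^-1).
- exact/shadow_sub/qmono.
- have := capacity_le muP sub; have := capacity_ge1C muP (shadow x y).
  by move: lt_half; lra.
- by exists (q n).
Qed.

Lemma shadows_meet A B : capacity_measurable mu A -> 1 < mu A + mu B -> A `&` B !=set0.
Proof.
move=> mA lt1; apply/set0P/eqP => AB; move: lt1; rewrite ltNge.
by rewrite (capacity_disjoint muP) // AB.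
Qed.

(** Otherwise start at x and move along points q whose shadow has mass more than
    1/2.  They form a chain, which lands at some p.  The heavy branch at p does
    not point back to x, since the shadow of p seen from x has mass at least 1/2;
    so it leads to a further point of the chain, beyond p. *)
Lemma central_nonempty : [set: X] !=set0 -> central !=set0.
Proof.
move=> [x _]; apply: contrapT => nK.
have nonc y : ~ central y by move=> Ky; apply: nK; exists y.
pose T : set X := [set q | 2^-1 < mu (shadow q x)].
have [||y|p [TA mup]] := @shadow_landing x T.
- by exists x; rewrite /T /= shadowxx; lra.
- move=> y y'; rewrite /T /= => hy hy'.
  have [|z [xzy xzy']] := shadows_meet (shadowM y x) (B := shadow y' x); first by lra.
  exact: (arc_total X_uac xzy xzy').
- exact: ltW.
have [q qp muq] := heavy_germ (nonc p).
have [|z [pzq xzp]] := shadows_meet (shadowM q p) (B := shadow p x); first by lra.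
have xqp := arc_btw xzp pzq.
have Tq : T q.
  apply: (lt_le_trans muq); apply: (capacity_le muP) => w pwq.
  exact: (arc_extend (nesym qp) xqp).
by apply: qp; apply: (anti (TA _ Tq) xqp).
Qed.

Lemma shadow_far (c b y : X) : ~ arc c y b -> shadow b c `<=` shadow b y.
Proof. by move=> ncyb z /(@arc_tripod _ _ X_uac c y z)[]. Qed.

Lemma central_of_shadow c b : central c -> 2^-1 <= mu (shadow b c) -> central b.
Proof.
move=> Kc mub y; have [cyb|ncyb] := pselect (arc c y b).
  apply: (le_trans (Kc y)); apply: (capacity_le muP) => z yzc.
  by apply: (arc_subl X_uac yzc); rewrite sym.
apply: (le_trans mub); apply: (capacity_le muP); exact: shadow_far.
Qed.

(* If two points of T were incomparable from x, their shadows and S would be three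
   disjoint sets of capacity at least 1/2. *)
Let chain_of_third x (T S : set X) : capacity_measurable mu S -> 2^-1 <= mu S ->
  (forall y, T y -> 2^-1 <= mu (shadow y x)) ->
  (forall y, T y -> y <> x -> S `&` shadow y x `<=` set0) -> chain x T.
Proof.
move=> mS muS muT ST y y' Ty Ty'.
have [->|yx] := pselect (y = x); first by left; exact: (arc_left X_uac).
have [->|y'x] := pselect (y' = x); first by right; exact: (arc_left X_uac).
have [[z [xzy xzy']]|disj] := pselect (shadow y x `&` shadow y' x !=set0).
  exact: (arc_total X_uac xzy xzy').
have := capacity_disjoint3 muP mS (shadowM y x) (ST _ Ty yx) (ST _ Ty' y'x).
have -> : shadow y x `&` shadow y' x = set0.
  by apply/eqP/negP => /negP/set0P.
by have := muT _ Ty; have := muT _ Ty' => h1 h2 /(_ (@subset_refl _ _)); lra.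
Qed.

(** From a central point c, the central points beyond another one c1 form a chain,
    with shadow c c1 as the third set.  It lands at a central point b that is
    extreme, so that shadow b c is disjoint from the shadows seen from b of all
    other central points.  Seen from b the central points therefore form a
    chain, and it lands at the other end a. *)
Lemma central_spanned c : central c ->
  exists a b, [/\ central a, central b & central `<=` arc a b].
Proof.
move=> Kc; have [[c1 [Kc1 cc1]]|single] := pselect (exists c1, central c1 /\ c1 <> c);
  last first.
  exists c, c; split=> // y Ky; rewrite (arcxx X_uac); apply: contrapT => yc.
  by apply: single; exists y.
pose T : set X := [set y | central y /\ arc c y c1].
have [||y [Ky _]|b [TA mub]] := @shadow_landing c T.
- by exists c1; split=> //; exact: (arc_right X_uac).
- apply: (chain_of_third (S := shadow c c1)) => //.
    by move=> y [Ky _].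
  move=> y [_ cyc1] _ z [c1zc czy].
  apply: (shadow_anti (x := c) (y := c1) (z := z)) => //; first exact: nesym.
  exact: (arc_subl X_uac czy).
- exact: Ky.
have Kb := central_of_shadow Kc mub.
have cbc1 : arc c b c1 by apply: TA; split=> //; exact: (arc_right X_uac).
have [||y Ky|a [KA mua]] := @shadow_landing b central.
- by exists c.
- apply: (chain_of_third (S := shadow b c)) => // y Ky yb z [czb bzy].
  have ncyb : ~ arc c y b.
    move=> cyb; apply: yb.
    apply: (anti (x := c)) => //; apply: TA; split=> //.
    exact: (arc_subl X_uac cyb).
  by apply: (shadow_anti (nesym yb) _ bzy); exact: (shadow_far ncyb czb).
- exact: Ky.
by exists b, a; split=> //; exact: central_of_shadow mua.
Qed.

Lemma central_homeo (h k : X -> X) x : continuous h -> continuous k ->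
  cancel h k -> cancel k h -> (forall A, mu (k @^-1` A) = mu A) ->
  central x -> central (h x).
Proof.
move=> hc kc hk kh muk Kx y; apply: (le_trans (Kx (k y))).
rewrite -muk; apply: (capacity_le muP) => z /(arc_homeo X_uac hc (can_inj hk)).
by rewrite !kh.
Qed.

Lemma arc_endpoints (a b u v : X) : arc a b u -> arc a b v -> arc u v a -> arc u v b ->
  u = a \/ u = b.
Proof.
move=> abu abv uva uvb; have [avu|auv] := arc_total X_uac abu abv.
  left; apply: (anti (x := v)); first by rewrite sym.
  by rewrite sym.
have va : v = a by apply: (anti (x := u)) => //; rewrite sym.
right; apply: (anti (x := a)) => //; rewrite sym -va //.
Qed.

End Endgame.

(** * Orbits of length at most two *)

Theorem theorem1p2 (R : realType) (X : metricType R) (G : groupType)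
    (act : G -> X -> X)
    (X_continuum : continuum [set: X])
    (X_uac : uniquely_arcwise_connected X)
    (G_countable : countable [set: G])
    (G_amenable : amenable R G)
    (act_homeo : action_by_homeomorphisms act) :
  exists x : X, (action_orbit act x #<= `I_2)%card.
Proof.
have [X_nonempty X_compact _] := X_continuum.
have [act_h act1 actM] := act_homeo.
have [x0 _] := X_nonempty.
have [m [mP m_inv]] := amenable_invariant_content actM x0 G_amenable.
have X_normal : normal_space X.
  by apply: compact_normal => //; exact: metric_hausdorff.
have muP := capacity_ofP mP X_normal X_compact.
have actC g : continuous (act g) by have [h []] := act_h g.
have actK g : cancel (act g) (act g^-1%g).
  by move=> x; rewrite -actM mulVg act1.
have actVK g : cancel (act g^-1%g) (act g).
  by move=> x; rewrite -actM mulgV act1.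
have mu_inv g A : capacity_of m (act g^-1%g @^-1` A) = capacity_of m A.
  by apply: (capacity_of_preimage mP (g := act g)).
have central_act g x : central_points (capacity_of m) x -> central_points (capacity_of m) (act g x).
  by apply: (central_homeo X_uac muP (actC g) (actC g^-1%g)) => //; exact: mu_inv.
have [c Kc] := central_nonempty X_compact X_uac muP X_nonempty.
have [a [b [Ka Kb K_ab]]] := central_spanned X_compact X_uac muP Kc.
have arc_act g x : central_points (capacity_of m) x -> arc (act g a) (act g b) x.
  move=> /(central_act g^-1%g)/K_ab/(arc_homeo X_uac (actC g) (can_inj (actK g))).
  by rewrite actVK.
exists a.
have sub : action_orbit act a `<=` (fun n => if n == 0%N then a else b) @` `I_2.
  move=> _ [g _ <-].
  have [-> | ->] : act g a = a \/ act g a = b.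
    apply: (arc_endpoints X_uac (v := act g b)).
    - exact/K_ab/central_act.
    - exact/K_ab/central_act.
    - exact: arc_act.
    - exact: arc_act.
  - by exists 0%N.
  - by exists 1%N.
exact: card_le_trans (subset_card_le sub) (card_image_le _ _).
Qed.
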